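(* Let $(\mathrm{X},\Sigma,\mu)$ be a measure space, let $(f_n)$ be a sequence in $\Lambda_1(\mathrm{X})$ and let $f$ be a measurable function. Assume that $(f_n)$ converges to $f$ almost everywhere and that there exists $g\in\Lambda_1(\mathrm{X})$ such that $\sup_n|f_n|\le g$ almost everywhere. Then $f\in\Lambda_1(\mathrm{X})$, and for every $\delta>0$ there exists a measurable set $E_\delta$ with $\mu(E_\delta)<\delta$ such that $$\int_{E_\delta^c}f_n\,d\mu\to\int_{E_\delta^c}f\,d\mu\qquad\text{as } n\to\infty.$$
   Context: Measurable functions are real-valued and identified $\mu$-a.e.; $L_0(\mathrm{X})$ denotes the space of such functions and $L_1(\mathrm{X})$ the usual Lebesgue space. $\Lambda_1(\mathrm{X})$ is the set of $f\in L_0(\mathrm{X})$ such that for every $\delta>0$ there exists $E_\delta\in\Sigma$ with $\mu(E_\delta)<\delta$ and $f\chi_{E_\delta^c}\in L_1(\mathrm{X})$. *)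

(* Defs.v *)
From HB Require Import structures.
From mathcomp Require Import all_boot all_order all_algebra.
From mathcomp Require Import all_classical all_reals all_analysis.
Set Implicit Arguments.
Unset Strict Implicit.
Unset Printing Implicit Defensive.
Import Order.TTheory GRing.Theory Num.Theory.
Import numFieldNormedType.Exports.
Local Open Scope classical_set_scope.
Local Open Scope ring_scope.

(* Elements of L_0(X) are given by representatives, i.e. measurable functions
   X -> R; membership in Lambda1 depends only on the class mod mu-a.e. equality
   because membership in [Lfun mu 1] does. *)
Definition Lambda1 (d : measure_display) (X : measurableType d) (R : realType)
    (mu : {measure set X -> \bar R}) : set (X -> R) :=
  [set f : X -> R | measurable_fun setT f /\
    forall delta : R, 0 < delta -> exists E : set X,
      [/\ measurable E, (mu E < delta%:E)%E
        & (fun x => f x * \1_(~` E) x) \in Lfun mu 1%E]].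

(* Main.v *)
(* The exceptional set supplied by [g] serves all the [f_ n] and [f] at once: off
   this set [g] is integrable and dominates, so dominated convergence applies. *)
Require Import Defs.
From HB Require Import structures.
From mathcomp Require Import all_boot all_order all_algebra.
From mathcomp Require Import all_classical all_reals all_analysis.
From mathcomp Require Import measurable_realfun.
Set Implicit Arguments.
Unset Strict Implicit.
Unset Printing Implicit Defensive.
Import Order.TTheory GRing.Theory Num.Theory.
Import numFieldNormedType.Exports.
Local Open Scope classical_set_scope.
Local Open Scope ring_scope.

Lemma Lfun1_indicC_integrable (d : measure_display) (X : measurableType d)
    (R : realType) (mu : {measure set X -> \bar R}) (f : X -> R) (E : set X) :
  measurable E ->
  (fun x => f x * \1_(~` E) x) \in Lfun mu 1%E <->
  mu.-integrable (~` E) (EFin \o f).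
Proof.
move=> mE; apply: iff_trans (Lfun1_integrable _ _) _.
rewrite -[X in EFin \o X]/(f \* \1_(~` E)) -patch_indic -restrict_EFin.
by apply: iff_sym; apply: integrable_mkcond; exact: measurableC.
Qed.

Lemma ae_dominated_integrable (d : measure_display) (X : measurableType d)
    (R : realType) (mu : {measure set X -> \bar R}) (D : set X)
    (f g : X -> \bar R) :
  measurable D -> measurable_fun D f -> mu.-integrable D g ->
  {ae mu, forall x, D x -> (`|f x| <= g x)%E} -> mu.-integrable D f.
Proof.
move=> mD mf ig fg.
(* Dominated convergence for the constant sequence [f]. *)
have [] // := @dominated_convergence _ _ _ mu _ mD (fun=> f) f g.
- by apply: aeW => x _; exact: cvg_cst.
- by apply: filterS fg => x fgx _; exact: fgx.
Qed.

Theorem proposition4p1 (d : measure_display) (X : measurableType d)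
    (R : realType) (mu : {measure set X -> \bar R})
    (f_ : nat -> X -> R) (f g : X -> R)
    (f_Lambda1 : forall n, Lambda1 mu (f_ n))
    (f_measurable : measurable_fun setT f)
    (f_cvg : {ae mu, forall x, f_ n x @[n --> \oo] --> f x})
    (g_Lambda1 : Lambda1 mu g)
    (f_le_g : {ae mu, forall x,
      (ereal_sup (range (fun n => `|f_ n x|%:E)) <= (g x)%:E)%E}) :
  Lambda1 mu f /\
  forall delta : R, 0 < delta -> exists E : set X,
    [/\ measurable E,
        (mu E < delta%:E)%E,
        forall n, mu.-integrable (~` E) (EFin \o f_ n),
        mu.-integrable (~` E) (EFin \o f)
      & (\int[mu]_(x in ~` E) (f_ n x)%:E)%E @[n --> \oo] -->
        (\int[mu]_(x in ~` E) (f x)%:E)%E].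
Proof.
have f_g : {ae mu, forall x n, `|f_ n x| <= g x}.
  apply: filterS f_le_g => x le_g n; rewrite -lee_fin.
  by apply: le_trans le_g; apply: ereal_sup_ubound; exists n.
have [_ gE] := g_Lambda1.
have main (delta : R) : 0 < delta -> exists E : set X,
    [/\ measurable E,
        (mu E < delta%:E)%E,
        forall n, mu.-integrable (~` E) (EFin \o f_ n),
        mu.-integrable (~` E) (EFin \o f)
      & (\int[mu]_(x in ~` E) (f_ n x)%:E)%E @[n --> \oo] -->
        (\int[mu]_(x in ~` E) (f x)%:E)%E].
  move=> /gE[E [mE muE /(Lfun1_indicC_integrable _ _ mE) ig]].
  have mEC : measurable (~` E) by exact: measurableC.
  have mf_ n : measurable_fun (~` E) (EFin \o f_ n).
    by apply/measurable_EFinP/measurable_funTS; have [] := f_Lambda1 n.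
  have mf : measurable_fun (~` E) (EFin \o f).
    exact/measurable_EFinP/measurable_funTS.
  have [] := @dominated_convergence _ _ _ mu _ mEC
    (fun n => EFin \o f_ n) (EFin \o f) (EFin \o g) mf_ mf _ ig _.
  - by apply: filterS f_cvg => x fx _; apply: cvg_EFin => //; exact: nearW.
  - by apply: filterS f_g => x fgx n _; rewrite /= lee_fin.
  move=> if_ _ cvg_int; exists E; split=> // n.
  apply: (ae_dominated_integrable mEC (mf_ n) ig).
  by apply: filterS f_g => x fgx _; rewrite /= lee_fin.
split=> //; split=> // delta /main[E [mE muE _ iE _]].
by exists E; split=> //; exact/Lfun1_indicC_integrable.
Qed.
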